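(* Let $\kappa_T(K_n)$ denote the translative kissing number of the $n$-dimensional cross-polytope $K_n$. Then $$\kappa_T(K_n)\leq 2.9162^{(1+o(1))n}\quad\text{as } n\to\infty,$$ i.e., there is a real sequence $(\varepsilon_n)_{n\ge 1}$ with $\varepsilon_n\to 0$ such that $\kappa_T(K_n)\leq 2.9162^{(1+\varepsilon_n)n}$ for all $n\geq 1$.
   Context: The cross-polytope is $K_n=\{x\in\mathbb{R}^n:\sum_{i=1}^n|x_i|\leq 1\}$, the unit ball of the norm $\|x\|_1=\sum_{i=1}^n|x_i|$. A kissing configuration of $K_n$ is a set $S\subset\mathbb{R}^n$ such that the translates $x+\frac12 K_n$ ($x\in S$) have pairwise disjoint interiors and each $x+\frac12 K_n$ intersects $\frac12 K_n$ only at its boundary (touching it); equivalently, $\|x\|_1=1$ for all $x\in S$ and $\|x-x'\|_1\geq 1$ for all distinct $x,x'\in S$. The translative kissing number $\kappa_T(K_n)$ is the maximum cardinality of a kissing configuration of $K_n$. *)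

(* Defs.v *)
From mathcomp Require Import all_boot all_order all_algebra.
From mathcomp Require Import all_classical all_reals all_analysis.
Import Order.TTheory GRing.Theory Num.Theory.
Import numFieldNormedType.Exports.

Set Implicit Arguments.
Unset Strict Implicit.
Unset Printing Implicit Defensive.

Local Open Scope classical_set_scope.
Local Open Scope ring_scope.

Definition cross_polytope (R : realType) (n : nat) : set 'rV[R]_n :=
  [set x | \sum_(i < n) `|x 0 i| <= 1].

Definition half_translate (R : realType) (n : nat) (K : set 'rV[R]_n)
  (x : 'rV[R]_n) : set 'rV[R]_n := [set x + 2^-1 *: y | y in K].

Definition boundary (T : topologicalType) (A : set T) : set T :=
  closure A `\` interior A.

(* The library topology on 'rV[R]_n is the product topology, i.e. the usual
   topology of R^n. In the last conjunct, half_translate K 0 is K / 2. *)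
Definition kissing_configuration (R : realType) (n : nat) (K : set 'rV[R]_n)
  (S : set 'rV[R]_n) : Prop :=
  trivIset S (fun x => interior (half_translate K x)) /\
  forall x, S x ->
    half_translate K x `&` half_translate K 0 !=set0 /\
    half_translate K x `&` half_translate K 0
      `<=` boundary (half_translate K 0).

(* [counting S] is the cardinality of S, +oo if S is infinite. The supremum is
   a maximum as soon as it is finite: see [translative_kissing_number_max]. *)
Definition translative_kissing_number (R : realType) (n : nat)
  (K : set 'rV[R]_n) : \bar R :=
  ereal_sup [set counting S | S in kissing_configuration K].

Lemma translative_kissing_number_max (R : realType) (n : nat)
    (K : set 'rV[R]_n) :
  (translative_kissing_number K < +oo)%E ->
  exists2 S, kissing_configuration K S &
    finite_set S /\ translative_kissing_number K = counting S.
Proof.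
set s := translative_kissing_number K => s_fin.
have ub S : kissing_configuration K S -> (counting S <= s)%E.
  by move=> KS; apply: ereal_sup_ubound; exists S.
have fin S : kissing_configuration K S -> finite_set S.
  move=> KS; apply: contrapT => infS.
  have := le_lt_trans (ub _ KS) s_fin.
  by rewrite /counting asboolF// ltxx.
have K0 : kissing_configuration K set0 by split=> [|x []]//; move=> x y [].
have s0 : (0 <= s)%E.
  apply: le_trans (ub _ K0); rewrite /counting.
  by case: ifPn; rewrite ?lee_fin// leey.
have sE : s = (fine s)%:E by rewrite fineK// ge0_fin_numE.
have [_ [S KS <-]] : exists2 y, [set counting S | S in kissing_configuration K] y
    & (s - 1%:E < y)%E.
  by apply: ub_ereal_sup_adherent; [exact: ltr01 | rewrite [ereal_sup _]sE].
move=> s1S; exists S => //; split; first exact: fin.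
apply/eqP; rewrite eq_le ub// andbT; apply: ge_ereal_sup => _ [S' KS' <-].
move: s1S (ub _ KS'); rewrite /counting !asboolT; [|exact: fin..].
move=> + S's; rewrite sE -EFinB lte_fin ltrBlDr => sS.
rewrite lee_fin ler_nat -ltnS -(ltr_nat R) -natr1.
by apply: le_lt_trans sS; rewrite -lee_fin -sE.
Qed.

(* Main.v *)
Require Import Defs.
From mathcomp Require Import all_boot all_order all_algebra.
From mathcomp Require Import all_classical all_reals all_analysis.
From mathcomp Require Import finmap ring lra zify.
Import Order.TTheory GRing.Theory Num.Theory.
Import numFieldNormedType.Exports.

(** The union of the disjoint translates of [K_n / 2] lies in [(3/2) K_n], so
    comparing Lebesgue measures gives [3 ^ n]. Measuring with a product
    probability instead of Lebesgue measure does better. Scale so that the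
    centres satisfy [sum_i |x_i| <= n]; then a typical point [y] of the half
    ball has nearly independent coordinates [Y] of density [exp (- 2 |y|)], and
    the half ball has volume about [e ^ n]. Give space the density
    [prod_i q (u_i)] with [q (u)] proportional to
    [2 ^ (- |u|) (1 + exp (- 2 |u|))]. By concavity [1 + s >= 2 ^ s] on [0, 1],
    so up to a constant

      [log2 (q (u)) >= - |u| + exp (- 2 |u|)].

    For a coordinate [t] of a centre, adding noise lengthens it on average by
    [E|t + Y| - |t| = exp (- 2 |t|) / 2], whereas
    [E (exp (- 2 |t + Y|)) = (|t| + 1/2) exp (- 2 |t|)]: the bonus pays for the
    lengthening, however the length of the centre is distributed over its
    coordinates. (Without the bonus, that is for an exponential [q], the
    lengthening would cost [1/2] per coordinate at sparse centres.)
    Hence every half ball has measure at least [2 ^ (- n) e ^ n / I ^ n] up to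
    subexponential factors, where
    [I = 2 (1 / ln 2 + 1 / (2 + ln 2))] is the integral of
    [2 ^ (- |u|) (1 + exp (- 2 |u|))], and the number of centres is at most
    about [(2 I / e) ^ n], with [2 I / e < 2.67].

    The argument is carried out on a grid, with finite sums in place of
    integrals; the room between [2.67] and [2.9162] absorbs a fixed mesh. With
    [101] grid steps per unit, rounding the centres gives integer vectors
    [X] with [sum_i |X_i| <= 102 n] at mutual distance more than [100 n]
    ([grid_code_correct]), so the balls of radius [50 n] around them are
    disjoint and their weights add up to at most [W ^ n], where [W] is the
    total one-dimensional weight ([weighted_packing]). The mean estimate above
    becomes [mean_displacement_le]; that a ball weighs almost what its mean
    suggests follows from exponential tail bounds ([product_chernoff],
    [typical_noise]), which yields [ball_weight_ge]. The resulting bound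
    [2 * 2.9 ^ n] holds from some dimension on ([code_bound_large]), so that
    [eps] can be taken to vanish there; below it any bound will do
    ([code_bound]). *)

Set Implicit Arguments.
Unset Strict Implicit.
Unset Printing Implicit Defensive.

Local Open Scope classical_set_scope.
Local Open Scope ring_scope.

(** * Two-sided geometric sums *)

(** Identifies ['I_K.*2.+1] with the integers of absolute value at most [K]. *)
Definition centered (K j : nat) : int := j%:Z - K%:Z.

Lemma absz_centered (K : nat) (j : 'I_K.*2.+1) : (absz (centered K j) <= K)%N.
Proof. by have := ltn_ord j; rewrite /centered; lia. Qed.

Lemma sum_centered (V : zmodType) (K : nat) (F : int -> V) :
  \sum_(j < K.*2.+1) F (centered K j) =
  F 0 + \sum_(1 <= k < K.+1) (F k%:Z + F (- k%:Z)).
Proof.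
elim: K => [|K IH].
  by rewrite big_ord_recl big_ord0 big_geq // /centered subr0.
rewrite big_nat_recr //= addrA -IH doubleS big_ord_recl big_ord_recr /=.
rewrite [LHS]addrC -[LHS]addrA; congr (_ + _); last first.
  by congr (_ + _); congr F; rewrite /centered /bump /=; lia.
by apply: eq_bigr => j _; congr F; rewrite /centered /= /bump; lia.
Qed.

Lemma sum_geom (R : realType) (r : R) (K : nat) :
  (1 - r) * \sum_(1 <= k < K.+1) r ^+ k = r - r ^+ K.+1.
Proof.
elim: K => [|K IH]; first by rewrite big_geq // expr1; ring.
by rewrite big_nat_recr //= mulrDr IH (exprS r K.+1); ring.
Qed.

Lemma sum_arith_geom (R : realType) (r : R) (K : nat) :
  (1 - r) ^+ 2 * \sum_(1 <= k < K.+1) k%:R * r ^+ k =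
  r - r ^+ K.+1 * (1 + K%:R * (1 - r)).
Proof.
elim: K => [|K IH]; first by rewrite big_geq // expr1; ring.
by rewrite big_nat_recr //= mulrDr IH (exprS r K.+1) -natr1; ring.
Qed.

(** The truncated subtraction makes [(k - T)%N] the positive part of [k - T],
    so shifting [k] by [T] only costs the factor [r ^+ T]. *)
Lemma sum_excess_le (R : realType) (r : R) (K T : nat) : 0 <= r < 1 ->
  \sum_(1 <= k < K.+1) (k - T)%N%:R * r ^+ k <= r ^+ T * (r / (1 - r) ^+ 2).
Proof.
move=> /andP[r0 r1]; elim: T K => [|T IH] K.
  rewrite expr0 mul1r ler_pdivlMr ?exprn_gt0 ?subr_gt0 // mulrC.
  under eq_bigr do rewrite subn0.
  rewrite sum_arith_geom gerBl mulr_ge0 ?exprn_ge0 // addr_ge0 // mulr_ge0 //.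
  by rewrite subr_ge0 ltW.
case: K => [|K].
  rewrite big_geq //; apply: mulr_ge0; first exact: exprn_ge0.
  by apply: divr_ge0 => //; apply/exprn_ge0; rewrite subr_ge0 ltW.
rewrite big_nat_recl //= subSS sub0n mul0r add0r exprS -mulrA.
apply: le_trans (ler_wpM2l r0 (IH K)); rewrite big_distrr /=.
case: K => [|K]; first by rewrite !big_geq.
by apply: ler_sum_nat => k _; rewrite subSS exprS mulrCA.
Qed.

(** The bonus pays for the lengthening, at every starting point [t]. Pairing
    [k] with [-k] turns the left side into [2 sum_k r ^ k (k - |t|)^+], which
    is at most [2 r ^ |t| r / (1 - r) ^ 2]. On the right, each of the two terms
    [r ^ (k + |t + k|)] and [r ^ (k + |t - k|)] is at least [r ^ (|t| + 2 k)].
    Both sides thus carry the factor [r ^ |t|], and the condition on [b] no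
    longer involves [t]. *)
Lemma mean_displacement_le (R : realType) (r b : R) (K : nat) (t : int) :
  0 <= r < 1 -> 0 <= b ->
  2 * (r / (1 - r) ^+ 2) <= b * (1 + 2 * \sum_(1 <= k < K.+1) (r ^+ 2) ^+ k) ->
  \sum_(j < K.*2.+1)
     r ^+ absz (centered K j) * ((absz (t + centered K j))%:R - (absz t)%:R) <=
  b * \sum_(j < K.*2.+1)
     r ^+ absz (centered K j) * r ^+ absz (t + centered K j).
Proof.
move=> /andP[r0 r1] b0 hb.
rewrite (sum_centered K
  (fun j => r ^+ absz j * ((absz (t + j))%:R - (absz t)%:R))).
rewrite (sum_centered K (fun j => r ^+ absz j * r ^+ absz (t + j))).
rewrite !addr0 subrr mulr0 add0r absz0 expr0 mul1r.
apply: (@le_trans _ _ (r ^+ absz t * (2 * (r / (1 - r) ^+ 2)))).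
  have r01 : 0 <= r < 1 by rewrite r0.
  rewrite [leRHS]mulrCA.
  apply: le_trans (ler_wpM2l (ler0n R 2) (sum_excess_le K (absz t) r01)).
  rewrite big_distrr /=; apply: ler_sum_nat => k _.
  rewrite abszN /= -mulrDr mulrA [leRHS]mulrC; apply: ler_wpM2l.
    exact: exprn_ge0.
  rewrite addrACA -opprD -!natrD lerBlDr -natrM -natrD ler_nat.
  by lia.
apply: le_trans (ler_wpM2l (exprn_ge0 _ r0) hb) _.
rewrite mulrCA; apply: ler_wpM2l => //.
rewrite mulrDr mulr1 lerD2l mulrCA !big_distrr /=.
apply: ler_sum_nat => k _; rewrite abszN /= -!exprD -exprM mulrDl mul1r.
by rewrite -!exprD; apply: lerD; apply: ler_wiXn2l; rewrite ?r0 ?ltW //; lia.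
Qed.

(** * Exponential tails for product weights *)

(** Markov's inequality for [exp (tau sum_i h_i)], which factors over the
    coordinates. As [exp v <= 1 + v + v ^ 2] for small [v], each factor is at
    most [(1 - tau eta + (tau F) ^ 2) Z]. *)
Lemma product_chernoff (R : realType) (J : finType) (p : J -> R)
    (Z F eta : R) (n : nat) (h : 'I_n -> J -> R) :
  (forall j, 0 <= p j) -> \sum_j p j = Z -> 0 < eta <= F ->
  (forall i j, `|h i j| <= F) ->
  (forall i, \sum_j p j * h i j <= - (eta * Z)) ->
  \sum_(Y : {ffun 'I_n -> J} | 0 <= \sum_i h i (Y i)) \prod_i p (Y i) <=
  ((1 - 2 / 9 * (eta / F) ^+ 2) * Z) ^+ n.
Proof.
move=> p0 pZ /andP[eta0 etaF] hF hmean.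
have F0 : 0 < F by apply: lt_le_trans etaF.
have Z0 : 0 <= Z by rewrite -pZ sumr_ge0.
(* [tau] is of the order of the optimal [eta / (2 F ^ 2)], and small enough
   for [|tau h| <= 1/3], where the quadratic bound on [exp] is valid *)
set tau := eta / (3 * F ^+ 2).
have tau0 : 0 < tau by rewrite divr_gt0 // mulr_gt0 // exprn_gt0.
have tauF : tau * F <= 1 / 3.
  rewrite /tau expr2 mulrA invfM mulrA divfK ?gt_eqF //.
  by rewrite invfM mulrCA mul1r ler_piMr ?invr_ge0 // ler_pdivrMr // mul1r.
have exp_quad (v : R) : `|v| <= 1 / 3 -> expR v <= 1 + v + v ^+ 2.
  rewrite ler_norml => /andP[v1 v2].
  have q0 : 0 < 1 + v + v ^+ 2 by have := sqr_ge0 v; lra.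
  have e0 := expR_gt0 v.
  (* bounding [exp (- v / 2)] and squaring is sharp enough, whereas the bound
     [1 - v] on [exp (- v)] itself is not when [v > 0] *)
  have H : (1 - v / 2) ^+ 2 <= (expR v)^-1.
    rewrite -expRN (_ : - v = - (v / 2) - v / 2); last by field.
    have v0 : 0 <= 1 - v / 2 by lra.
    by rewrite expRD expr2 ler_pM // expR_ge1Dx.
  have H2 : (1 - v / 2) ^+ 2 * (1 + v + v ^+ 2) >= 1 by nra.
  have : 1 <= (expR v)^-1 * (1 + v + v ^+ 2).
    by apply: le_trans H2 _; apply: ler_wpM2r; [exact: ltW | exact: H].
  by rewrite ler_pdivlMl // mulr1.
apply: (@le_trans _ _
   (\sum_(Y : {ffun 'I_n -> J}) \prod_i (p (Y i) * expR (tau * h i (Y i))))).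
  rewrite [leRHS](bigID (fun Y : {ffun 'I_n -> J} => 0 <= \sum_i h i (Y i))) /=.
  rewrite -[leLHS]addr0; apply: lerD; last first.
    by apply: sumr_ge0 => Y _; apply: prodr_ge0 => i _; exact: mulr_ge0.
  apply: ler_sum => Y hY; rewrite big_split /= ler_peMr //.
    by apply: prodr_ge0.
  rewrite -expR_sum -mulr_sumr -expR0 ler_expR mulr_ge0 //.
  exact: ltW.
rewrite -(bigA_distr_bigA (fun i j => p j * expR (tau * h i j))) /=.
rewrite -[X in _ ^+ X](card_ord n) -prodr_const.
apply: ler_prod => i _; apply/andP; split.
  by apply: sumr_ge0 => j _; rewrite mulr_ge0 ?expR_ge0.
apply: (@le_trans _ _
  (\sum_j (p j + tau * (p j * h i j) + (tau * F) ^+ 2 * p j))).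
  apply: ler_sum => j _.
  have htF : `|tau * h i j| <= tau * F by rewrite normrM gtr0_norm // ler_pM2l.
  have : expR (tau * h i j) <= 1 + tau * h i j + (tau * F) ^+ 2.
    apply: le_trans (exp_quad _ (le_trans htF tauF)) _.
    rewrite lerD2l -real_normK ?num_real //.
    by rewrite lerXn2r ?nnegrE // mulr_ge0 ?ltW.
  move=> /(ler_wpM2l (p0 j)) /le_trans; apply.
  by lra.
rewrite !big_split /= -!mulr_sumr pZ.
have -> : (1 - 2 / 9 * (eta / F) ^+ 2) * Z =
    Z + tau * (- (eta * Z)) + (tau * F) ^+ 2 * Z.
  by rewrite /tau; field; rewrite gt_eqF.
by rewrite lerD2r lerD2l ler_pM2l.
Qed.

(** * Weighted packing *)

(** The points [X x + Y] with [Y] in the ball of radius [r] are pairwise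
    distinct and lie in the box of half-side [M], and the weight of that box is
    the right-hand side, expanded by distributivity. *)
Lemma weighted_packing (R : realType) (T : finType) (n K r M : nat)
    (X : T -> 'I_n -> int) (w : int -> R) :
  (forall k, 0 <= w k) ->
  (forall x i, (absz (X x i) + K <= M)%N) ->
  (forall x x', x != x' -> (r.*2 < \sum_i absz (X x i - X x' i))%N) ->
  \sum_x \sum_(Y : {ffun 'I_n -> 'I_K.*2.+1} |
                (\sum_i absz (centered K (Y i)) <= r)%N)
     \prod_i w (X x i + centered K (Y i)) <=
  (\sum_(j < M.*2.+1) w (centered M j)) ^+ n.
Proof.
move=> w0 XM Xsep.
rewrite pair_big_dep /=.
pose translate (u : T * {ffun 'I_n -> 'I_K.*2.+1}) :
    {ffun 'I_n -> 'I_M.*2.+1} :=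
  [ffun i => inord (absz (X u.1 i + centered K (u.2 i) + M%:Z))].
have translateE u i :
    centered M (translate u i) = X u.1 i + centered K (u.2 i).
  have := XM u.1 i; have := absz_centered (u.2 i).
  by rewrite ffunE /centered => ? ?; rewrite inordK; lia.
have dist_le (Y Y' : 'I_n -> int) : (\sum_i absz (Y i) <= r)%N ->
    (\sum_i absz (Y' i) <= r)%N -> (\sum_i absz (Y' i - Y i) <= r.*2)%N.
  move=> Yr Y'r; rewrite -addnn; apply: leq_trans (leq_add Yr Y'r).
  by rewrite -big_split /=; apply: leq_sum => i _; lia.
have translate_inj :
    {in [pred u : T * {ffun 'I_n -> 'I_K.*2.+1} |
      (\sum_i absz (centered K (u.2 i)) <= r)%N] &,
      injective translate}.
  move=> [x Y] [x' Y']; rewrite !inE /= => Yr Y'r eqt.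
  have eqi i : X x i + centered K (Y i) = X x' i + centered K (Y' i).
    by rewrite -(translateE (x, Y)) eqt translateE.
  have eqx : x = x'.
    apply/eqP; apply: contraT => /Xsep.
    rewrite ltnNge (_ : \sum_i absz (X x i - X x' i) =
      \sum_i absz (centered K (Y' i) - centered K (Y i)))%N ?dist_le //.
    by apply: eq_bigr => i _; have := eqi i; lia.
  rewrite eqx; congr pair; apply/ffunP => i; apply: val_inj.
  by have := eqi i; rewrite eqx /centered /=; lia.
rewrite -[X in _ ^+ X](card_ord n) -prodr_const bigA_distr_bigA /=.
under eq_bigr => u _ do under eq_bigr => i _ do rewrite -translateE.
rewrite -(big_imset (fun f : {ffun 'I_n -> 'I_M.*2.+1} =>
  \prod_i w (centered M (f i))) translate_inj) /=.
rewrite [leRHS](bigID (mem [set translate u | u in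
  [pred u : T * {ffun 'I_n -> 'I_K.*2.+1} |
    (\sum_i absz (centered K (u.2 i)) <= r)%N]]%SET)) /=.
by rewrite lerDl; apply: sumr_ge0 => f _; apply: prodr_ge0.
Qed.

(** * The weight and the noise on the grid *)

(** With [50 n] grid steps as radius, [rho] plays the part of
    [exp (- 2 / 101)]: the mean of [|j|] under the weights [rho ^ |j|] is
    [2 rho / (1 - rho ^ 2)], about [49.495], just below [50]. *)
Definition rho (R : realType) : R := 49%:R / 50%:R.

(** Plays the part of [2 ^ (- 1 / 102)], slightly rounded up so that
    [mu ^ 102 >= 1/2]. *)
Definition mu (R : realType) : R := 149%:R / 150%:R.

Definition weight (R : realType) (k : int) : R :=
  mu R ^+ absz k * (1 + rho R ^+ absz k).

Lemma rho_gt0 (R : realType) : 0 < rho R. Proof. by rewrite /rho; lra. Qed.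
Lemma rho_lt1 (R : realType) : rho R < 1. Proof. by rewrite /rho; lra. Qed.
Lemma mu_gt0 (R : realType) : 0 < mu R. Proof. by rewrite /mu; lra. Qed.
Lemma mu_lt1 (R : realType) : mu R < 1. Proof. by rewrite /mu; lra. Qed.

Lemma weight_ge0 (R : realType) k : 0 <= weight R k.
Proof.
have [r0 m0] := (ltW (rho_gt0 R), ltW (mu_gt0 R)).
by rewrite mulr_ge0 ?addr_ge0 ?exprn_ge0.
Qed.

(** Over all integers, the two geometric series sum to [(1 + mu) / (1 - mu) = 299] and
    [(1 + mu rho) / (1 - mu rho) < 74.5]. *)
Lemma sum_weight_le (R : realType) (M : nat) :
  \sum_(j < M.*2.+1) weight R (centered M j) <= 3735 / 10.
Proof.
rewrite (sum_centered M (weight R)).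
have -> : \sum_(1 <= k < M.+1) (weight R k%:Z + weight R (- k%:Z)) =
    2 * (\sum_(1 <= k < M.+1) mu R ^+ k) +
    2 * (\sum_(1 <= k < M.+1) (mu R * rho R) ^+ k).
  rewrite -mulrDr -big_split /= big_distrr /=; apply: eq_bigr => k _.
  by rewrite /weight abszN /= (exprMn _ (mu R) (rho R)); ring.
have := sum_geom (mu R) M; have := sum_geom (mu R * rho R) M.
have m0 : 0 <= mu R ^+ M.+1 by rewrite exprn_ge0 // ltW // mu_gt0.
have mr0 : 0 <= (mu R * rho R) ^+ M.+1.
  by rewrite exprn_ge0 // ltW // mulr_gt0 ?mu_gt0 ?rho_gt0.
by rewrite /weight absz0 !expr0 /mu /rho in m0 mr0 *; lra.
Qed.

Definition noise_mass (R : realType) (K : nat) : R :=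
  \sum_(j < K.*2.+1) rho R ^+ absz (centered K j).

Definition noise_moment (R : realType) (K : nat) : R :=
  \sum_(j < K.*2.+1) rho R ^+ absz (centered K j) * (absz (centered K j))%:R.

(** [K] is so large that cutting the noise off at [K] is harmless. *)
Definition long_range (R : realType) (K : nat) : Prop :=
  rho R ^+ K * (K%:R + 50) <= 1 / 20.

Lemma rho_tail (R : realType) (K : nat) : long_range R K ->
  0 <= rho R ^+ K <= 1 / 1000.
Proof.
have rhoK0 : 0 <= rho R ^+ K by rewrite exprn_ge0 // ltW // rho_gt0.
have := mulr_ge0 rhoK0 (ler0n R K); rewrite /long_range mulrDr rhoK0.
by set x := rho R ^+ K; set y := x * _; lra.
Qed.

Lemma noise_mass_bounds (R : realType) (K : nat) : long_range R K ->
  989 / 10 <= noise_mass R K <= 99.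
Proof.
move=> tailK; have /andP[rhoK0 rhoK_le] := rho_tail tailK.
rewrite /noise_mass (sum_centered K (fun j => rho R ^+ absz j)).
under eq_bigr do rewrite abszN /= -mulr2n.
rewrite sumrMnl.
have := sum_geom (rho R) K; rewrite (exprS _ K).
by move: rhoK0 rhoK_le; rewrite expr0 /rho; lra.
Qed.

Lemma noise_moment_bounds (R : realType) (K : nat) : long_range R K ->
  4890 <= noise_moment R K <= 4900.
Proof.
move=> tailK; have /andP[rhoK0 rhoK_le] := rho_tail tailK.
rewrite /noise_moment (sum_centered K (fun j => rho R ^+ absz j * (absz j)%:R)).
under eq_bigr do rewrite abszN /= mulrC -mulr2n.
rewrite sumrMnl /= mulr0 add0r.
have := sum_arith_geom (rho R) K; rewrite (exprS _ K).
have : 0 <= rho R ^+ K * K%:R by rewrite mulr_ge0.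
by move: rhoK0 rhoK_le tailK; rewrite /long_range /rho; lra.
Qed.

(** By [ln_mu_le] a grid step of length costs at most [ln 2 / 102] in
    [ln weight], against a bonus of [ln 2] times [rho ^ |t + s|]: so [102] is
    the rate of exchange needed. *)
Lemma noise_displacement_le (R : realType) (K : nat) (t : int) :
  long_range R K ->
  \sum_(j < K.*2.+1) rho R ^+ absz (centered K j) *
     ((absz (t + centered K j))%:R - (absz t)%:R) <=
  102 * \sum_(j < K.*2.+1)
     rho R ^+ absz (centered K j) * rho R ^+ absz (t + centered K j).
Proof.
move=> tailK; have /andP[rhoK0 rhoK_le] := rho_tail tailK.
apply: mean_displacement_le => //; first by rewrite /rho; lra.
have -> : 2 * (rho R / (1 - rho R) ^+ 2) = 4900 by rewrite /rho; field.
have := sum_geom (rho R ^+ 2) K; rewrite (exprS _ K) (exprAC _ 2 K).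
have : (rho R ^+ K) ^+ 2 <= 1 / 1000 by move: rhoK0 rhoK_le; nra.
by set q := (rho R ^+ K) ^+ 2; set S := \sum_(_ <= k < _) _; rewrite /rho; lra.
Qed.

Lemma exists_long_range (R : realType) :
  exists K : nat, long_range R K.
Proof. by exists 500%N; rewrite /long_range /rho; lra. Qed.

(** * The weight of a ball *)

Lemma exp_ln2_le (R : realType) (s : R) : 0 <= s <= 1 ->
  expR (ln 2 * s) <= 1 + s.
Proof.
move=> s01; have := convex_expR (Itv01 (andP s01).1 (andP s01).2) (ln 2) 0.
rewrite !convRE /= expR0 lnK ?posrE // mulr0 addr0 mulr1 /unstable.onem.
by rewrite mulrC => /le_trans; apply; lra.
Qed.

Lemma half_expr_le (R : realType) (n m : nat) : (m <= 102 * n)%N ->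
  2^-1 ^+ n <= mu R ^+ m.
Proof.
have [m0 m1] := (mu_gt0 R, mu_lt1 R) => mn.
apply: (@le_trans _ _ (mu R ^+ (102 * n))).
  rewrite exprM lerXn2r ?nnegrE ?invr_ge0 ?exprn_ge0 ?(ltW m0) //.
  by rewrite /mu; clear; lra.
by apply: ler_wiXn2l => //; exact: ltW.
Qed.

Lemma eventually_expr_le (R : realType) (q e : R) : 0 <= q < 1 -> 0 < e ->
  exists n0, forall n, (n0 <= n)%N -> q ^+ n <= e.
Proof.
move=> /andP[q0 q1] e0.
have /cvgr_lt : q ^+ n @[n --> \oo] --> (0 : R).
  by apply: cvg_expr; rewrite ger0_norm.
move=> /(_ _ e0) [n0 _ H]; exists n0 => n hn; exact/ltW/H.
Qed.

Lemma exp_nat_ln (R : realType) (x : R) (m : nat) : 0 < x ->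
  x ^+ m = expR (- (- ln x * m%:R)).
Proof. by move=> x0; rewrite mulNr opprK mulrC expRM_natl lnK. Qed.

Lemma rho_powers (R : realType) (m : nat) : 0 <= rho R ^+ m <= 1.
Proof.
have [r0 r1] := (rho_gt0 R, rho_lt1 R).
by rewrite exprn_ge0 ?exprn_ile1 // ltW.
Qed.

Lemma decay_rates_gt0 (R : realType) : 0 < - ln (rho R) /\ 0 < - ln (mu R).
Proof.
by split; rewrite oppr_gt0 ln_lt0 // ?rho_gt0 ?rho_lt1 ?mu_gt0 ?mu_lt1.
Qed.

Lemma ln_mu_le (R : realType) : 102 * - ln (mu R) <= ln 2.
Proof.
have m0 := mu_gt0 R.
rewrite -ler_expR lnK ?posrE // -[_ * _]opprK expRN (mulrC 102) -exp_nat_ln //.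
by rewrite invf_ple ?posrE ?exprn_gt0 // /mu; lra.
Qed.

(** Lower bound for [ln (weight (t + s) / (mu ^ |t| rho ^ |s|))], the
    logarithmic density of the weight against the noise (see
    [weight_ge_gain]), where the factor [1 + v] of the weight has
    been replaced by [2 ^ v]. *)
Definition gain (R : realType) (t s : int) : R :=
  - ln (rho R) * (absz s)%:R + ln 2 * rho R ^+ absz (t + s)
  - - ln (mu R) * ((absz (t + s))%:R - (absz t)%:R).

Lemma weight_ge_gain (R : realType) (t s : int) :
  mu R ^+ absz t * (rho R ^+ absz s * expR (gain R t s)) <= weight R (t + s).
Proof.
have [r0 m0] := (rho_gt0 R, mu_gt0 R).
have := exp_ln2_le (rho_powers R (absz (t + s))).
move=> /(ler_wpM2l (exprn_ge0 (absz (t + s)) (ltW m0))); apply: le_trans.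
rewrite !(exp_nat_ln _ m0) (exp_nat_ln (absz s) r0) -!expRD ler_expR.
by rewrite /gain; lra.
Qed.

(** On average the last two terms of [gain] have a nonnegative sum by
    [noise_displacement_le], and the first one contributes the mean of [|s|],
    which exceeds [49]. *)
Lemma gain_mean (R : realType) (K : nat) (t : int) : long_range R K ->
  \sum_(j < K.*2.+1) rho R ^+ absz (centered K j) *
      (48 * - ln (rho R) - gain R t (centered K j)) <=
  - (- ln (rho R) / 4 * noise_mass R K).
Proof.
move=> tailK.
have /andP[_ Z2] := noise_mass_bounds tailK.
have /andP[D1 _] := noise_moment_bounds tailK.
have disp := noise_displacement_le t tailK.
have [a0 l0] := decay_rates_gt0 R.
have ln2_l := ln_mu_le R.
rewrite /gain.
move: (- ln (rho R)) (- ln (mu R)) a0 l0 ln2_l => a l a0 l0 ln2_l.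
rewrite (eq_bigr (fun j : 'I_K.*2.+1 => 48 * a * rho R ^+ absz (centered K j)
    - a * (rho R ^+ absz (centered K j) * (absz (centered K j))%:R)
    - ln 2 * (rho R ^+ absz (centered K j) * rho R ^+ absz (t + centered K j))
    + l * (rho R ^+ absz (centered K j) *
        ((absz (t + centered K j))%:R - (absz t)%:R)))); last first.
  by move=> j _; ring.
rewrite big_split /= !sumrB -!mulr_sumr.
rewrite -/(noise_mass R K) -/(noise_moment R K).
move: disp; set S1 := \sum_j _; set S2 := \sum_j _ => S12.
have S20 : 0 <= S2.
  by apply: sumr_ge0 => j _; rewrite mulr_ge0 // exprn_ge0 // ltW // rho_gt0.
have {S12 S20} lS : l * S1 <= ln 2 * S2.
  apply: le_trans (ler_wpM2r S20 ln2_l).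
  by rewrite (mulrC 102) -mulrA ler_pM2l.
have : 0 <= a * (noise_moment R K - (48 + 1 / 4) * noise_mass R K).
  by apply: mulr_ge0; [exact: ltW | clear -Z2 D1; lra].
clear -lS; lra.
Qed.

Lemma absz_triangle (s t : int) (K : nat) : (absz s <= K)%N ->
  (absz (t + s)%R <= absz t + K)%N /\ (absz t <= absz (t + s)%R + K)%N.
Proof. lia. Qed.

Lemma gain_bounded (R : realType) (K : nat) (t s : int) : (absz s <= K)%N ->
  `|48 * - ln (rho R) - gain R t s| <=
  48 * - ln (rho R) + - ln (rho R) * K%:R + ln 2 + - ln (mu R) * K%:R.
Proof.
move=> sK; have [] := absz_triangle t sK; move: sK.
rewrite -!(ler_nat R) !natrD => sK ts1 ts2.
have [a0 l0] := decay_rates_gt0 R.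
have ln2 : 0 <= ln 2 :> R by rewrite ln_ge0 // ler1n.
have /andP[q0 q1] := rho_powers R (absz (t + s)).
have s0 := ler0n R (absz s).
rewrite /gain ler_norml.
move: (- ln (rho R)) (- ln (mu R)) (ln 2) (_ ^+ _) a0 l0 ln2 q0 q1
  => a l e q a0 l0 e0 q0 q1.
set d := _ - (absz t)%:R.
have d1 : - K%:R <= d by rewrite /d; lra.
have d2 : d <= K%:R by rewrite /d; lra.
move: d1 d2 sK s0; move: d (absz s)%:R (K%:R) => {ts1 ts2} d x k d1 d2 xk x0.
have := ler_wpM2l (ltW a0) xk; have := mulr_ge0 (ltW a0) x0.
have := ler_wpM2l (ltW l0) d1; have := ler_wpM2l (ltW l0) d2.
have := mulr_ge0 e0 q0; have := ler_wpM2l e0 q1.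
have : 0 <= 48 * a by rewrite mulr_ge0 ?ltW.
clear; lra.
Qed.

Lemma chernoff_rate (R : realType) (eta F : R) : 0 < eta <= F ->
  0 <= 1 - 2 / 9 * (eta / F) ^+ 2 < 1.
Proof.
move=> /andP[e0 eF]; have F0 := lt_le_trans e0 eF.
have q0 : 0 < eta / F by rewrite divr_gt0.
have q1 : eta / F <= 1 by rewrite ler_pdivrMr // mul1r.
by move: (eta / F) q0 q1 => q; clear; nra.
Qed.

Definition noise_weight (R : realType) (K n : nat)
    (Y : {ffun 'I_n -> 'I_K.*2.+1}) : R :=
  \prod_i rho R ^+ absz (centered K (Y i)).

Lemma noise_weight_ge0 (R : realType) (K n : nat)
  (Y : {ffun 'I_n -> 'I_K.*2.+1}) : 0 <= noise_weight R Y.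
Proof. by apply: prodr_ge0 => i _; apply: exprn_ge0; apply/ltW/rho_gt0. Qed.

(** Noise vectors that leave the ball or whose total gain is too small make up
    at most a quarter of the total mass each: both the mean length per
    coordinate, below [49.6], and the mean gain, above [49] times
    [- ln rho], are on the right side of [50] and [48] by a fixed margin. The
    dimension from which this holds is the same for all centres [X]. *)
Lemma typical_noise (R : realType) (K : nat) : long_range R K ->
  exists n0, forall n, (n0 <= n)%N -> forall X : 'I_n -> int,
    noise_mass R K ^+ n / 2 <=
    \sum_(Y : {ffun 'I_n -> 'I_K.*2.+1} |
           (\sum_i absz (centered K (Y i)) <= 50 * n)%N &&
           (48 * n%:R * - ln (rho R) <= \sum_i gain R (X i) (centered K (Y i))))
      noise_weight R Y.
Proof.
move=> tailK.
have /andP[Z1 Z2] := noise_mass_bounds tailK.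
have /andP[_ D2] := noise_moment_bounds tailK.
have p0 (j : 'I_K.*2.+1) : 0 <= rho R ^+ absz (centered K j).
  by case/andP: (rho_powers R (absz (centered K j))).
have mean1 : \sum_(j < K.*2.+1) rho R ^+ absz (centered K j) *
    ((absz (centered K j))%:R - 50) <= - (1 / 4 * noise_mass R K).
  under eq_bigr do rewrite mulrBr.
  rewrite sumrB -mulr_suml -/(noise_mass R K) -/(noise_moment R K).
  clear -Z1 D2; lra.
have range1 (j : 'I_K.*2.+1) :
    `|(absz (centered K j))%:R - 50| <= K%:R + 50 :> R.
  have := absz_centered j; rewrite -(ler_nat R) ler_norml.
  by have := ler0n R (absz (centered K j)); clear; lra.
have eta1 : 0 < (1 / 4 : R) <= K%:R + 50 by have := ler0n R K; clear; lra.
have [a0 l0] := decay_rates_gt0 R.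
have ln2 : 0 <= ln 2 :> R by rewrite ln_ge0 // ler1n.
have eta2 : 0 < - ln (rho R) / 4 <=
    48 * - ln (rho R) + - ln (rho R) * K%:R + ln 2 + - ln (mu R) * K%:R.
  have := mulr_ge0 (ltW a0) (ler0n R K); have := mulr_ge0 (ltW l0) (ler0n R K).
  by clear -a0 ln2; lra.
have quarter : 0 < 1 / 4 :> R by clear; lra.
have [n1 Hn1] := eventually_expr_le (chernoff_rate eta1) quarter.
have [n2 Hn2] := eventually_expr_le (chernoff_rate eta2) quarter.
exists (maxn n1 n2) => n; rewrite geq_max => /andP[/Hn1 {}Hn1 /Hn2 {}Hn2] X.
have Zn0 : 0 <= noise_mass R K ^+ n by rewrite exprn_ge0 //; clear -Z1; lra.
pose bad1 (Y : {ffun 'I_n -> 'I_K.*2.+1}) :=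
  0 <= \sum_i ((absz (centered K (Y i)))%:R - 50 : R).
pose bad2 (Y : {ffun 'I_n -> 'I_K.*2.+1}) :=
  0 <= \sum_i (48 * - ln (rho R) - gain R (X i) (centered K (Y i))).
have bad1_le : \sum_(Y | bad1 Y) noise_weight R Y <=
    1 / 4 * noise_mass R K ^+ n.
  apply: le_trans (ler_wpM2r Zn0 Hn1); rewrite -exprMn.
  exact: product_chernoff p0 erefl eta1 (fun=> range1) (fun=> mean1).
have bad2_le : \sum_(Y | bad2 Y) noise_weight R Y <=
    1 / 4 * noise_mass R K ^+ n.
  apply: le_trans (ler_wpM2r Zn0 Hn2); rewrite -exprMn.
  exact: product_chernoff p0 erefl eta2
    (fun i j => gain_bounded R (X i) (absz_centered j))
    (fun i => gain_mean (X i) tailK).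
have Zn : noise_mass R K ^+ n =
    \sum_(Y : {ffun 'I_n -> 'I_K.*2.+1}) noise_weight R Y.
  rewrite /noise_weight.
  rewrite -(bigA_distr_bigA (fun _ (j : 'I_K.*2.+1) =>
    rho R ^+ absz (centered K j))).
  by rewrite /= prodr_const card_ord.
have : noise_mass R K ^+ n <=
    \sum_(Y | ~~ bad1 Y && ~~ bad2 Y) noise_weight R Y +
    \sum_(Y | bad1 Y) noise_weight R Y + \sum_(Y | bad2 Y) noise_weight R Y.
  rewrite Zn (big_mkcond (fun Y => ~~ bad1 Y && ~~ bad2 Y)).
  rewrite (big_mkcond bad1) (big_mkcond bad2) -!big_split /=.
  apply: ler_sum => Y _; have := noise_weight_ge0 R Y.
  by case: (bad1 Y); case: (bad2 Y) => /=; clear; lra.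
move=> total; apply: (@le_trans _ _
    (\sum_(Y | ~~ bad1 Y && ~~ bad2 Y) noise_weight R Y)).
  by move: bad1_le bad2_le total; clear; lra.
rewrite big_mkcond [leRHS]big_mkcond /=; apply: ler_sum => Y _.
have w0 := noise_weight_ge0 R Y.
case: ifP => [/andP[]|_]; last by case: ifP.
rewrite /bad1 /bad2 -!ltNge !sumrB !sumr_const card_ord !subr_lt0 -natr_sum.
rewrite -mulrnA ltr_nat => /ltnW -> /=.
by rewrite -[_ *+ n]mulr_natr mulrAC => /ltW ->.
Qed.

(** A typical noise vector [Y] satisfies
    [weight (X + Y) >= 2 ^ (- n) rho ^ (- 48 n) noise_weight Y], and typical
    vectors carry half of the mass [noise_mass ^ n]. *)
Lemma ball_weight_ge (R : realType) (K : nat) : long_range R K ->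
  exists n0, forall n, (n0 <= n)%N -> forall X : 'I_n -> int,
    (\sum_i absz (X i) <= 102 * n)%N ->
    (noise_mass R K / (2 * rho R ^+ 48)) ^+ n / 2 <=
    \sum_(Y : {ffun 'I_n -> 'I_K.*2.+1} |
           (\sum_i absz (centered K (Y i)) <= 50 * n)%N)
      \prod_i weight R (X i + centered K (Y i)).
Proof.
move=> /typical_noise[n0 typical]; exists n0 => n /typical {}typical X hX.
have [r0 m0] := (rho_gt0 R, mu_gt0 R).
pose c := (2 * rho R ^+ 48)^-1.
have c0 : 0 <= c by rewrite invr_ge0 mulr_ge0 // exprn_ge0 // ltW.
have good_weight (Y : {ffun 'I_n -> 'I_K.*2.+1}) :
    48 * n%:R * - ln (rho R) <= \sum_i gain R (X i) (centered K (Y i)) ->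
    c ^+ n * noise_weight R Y <= \prod_i weight R (X i + centered K (Y i)).
  move=> gainY; apply: (@le_trans _ _ (\prod_i (mu R ^+ absz (X i) *
      (rho R ^+ absz (centered K (Y i)) *
        expR (gain R (X i) (centered K (Y i))))))).
    rewrite !big_split /= -expR_sum -expr_sum mulrCA mulrC.
    apply: ler_wpM2l; first exact: noise_weight_ge0.
    rewrite /c invfM exprMn.
    apply: ler_pM; rewrite ?exprn_ge0 ?invr_ge0 ?exprn_ge0 ?(ltW r0) //.
      exact: half_expr_le.
    rewrite (exp_nat_ln _ r0) -expRN opprK -expRM_natl ler_expR.
    by move: gainY; set a := ln _; clear; lra.
  apply: ler_prod => i _; rewrite weight_ge_gain andbT.
  by rewrite !mulr_ge0 ?exprn_ge0 ?expR_ge0 ?(ltW m0) ?(ltW r0).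
apply: (@le_trans _ _ (c ^+ n * (noise_mass R K ^+ n / 2))).
  by rewrite -/c exprMn [leRHS]mulrA (mulrC (c ^+ n)).
apply: le_trans (ler_wpM2l (exprn_ge0 n c0) (typical X)) _.
rewrite mulr_sumr big_mkcond [leRHS]big_mkcond /=; apply: ler_sum => Y _.
have w0 : 0 <= \prod_i weight R (X i + centered K (Y i)).
  by apply: prodr_ge0 => i _; apply: weight_ge0.
case: ifP => [/andP[-> /good_weight//]|_]; by case: ifP.
Qed.

(** * Bounds for separated sets of integer vectors *)

(** What remains of a kissing configuration after scaling by [101 n] and
    rounding to integers. *)
Definition code (n : nat) (T : finType) (X : T -> 'I_n -> int) : Prop :=
  (forall x, \sum_i absz (X x i) <= 102 * n)%N /\
  (forall x x', x != x' -> 100 * n < \sum_i absz (X x i - X x' i))%N.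

Lemma code_packing (R : realType) (n K : nat) (T : finType)
    (X : T -> 'I_n -> int) : code X ->
  \sum_x \sum_(Y : {ffun 'I_n -> 'I_K.*2.+1} |
      (\sum_i absz (centered K (Y i)) <= 50 * n)%N)
    \prod_i weight R (X x i + centered K (Y i)) <= (3735 / 10) ^+ n.
Proof.
move=> [Xle Xsep]; apply: (@le_trans _ _
    ((\sum_(j < (102 * n + K).*2.+1)
        weight R (centered (102 * n + K) j)) ^+ n)).
  apply: weighted_packing => [|x i|x x' /Xsep]; first exact: weight_ge0.
    rewrite leq_add2r; apply: leq_trans (Xle x).
    by rewrite (bigD1 i) //= leq_addr.
  by rewrite -muln2 mulnAC.
have W0 (M : nat) : 0 <= \sum_(j < M.*2.+1) weight R (centered M j).
  by apply: sumr_ge0 => j _; apply: weight_ge0.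
apply: lerXn2r; rewrite ?nnegrE; [exact: W0 | | exact: sum_weight_le].
exact: le_trans (W0 0%N) (sum_weight_le R 0).
Qed.

(** Only the centre of each ball is counted. *)
Lemma code_bound (R : realType) (n : nat) (T : finType)
    (X : T -> 'I_n -> int) : code X -> #|T|%:R <= 747 ^+ n :> R.
Proof.
move=> codeX; have [Xle _] := codeX; have := code_packing R 0 codeX.
have [m0 r0] := (mu_gt0 R, rho_gt0 R).
have term x : 2^-1 ^+ n <= \sum_(Y : {ffun 'I_n -> 'I_0.*2.+1} |
      (\sum_i absz (centered 0 (Y i)) <= 50 * n)%N)
    \prod_i weight R (X x i + centered 0 (Y i)).
  pose Y0 : {ffun 'I_n -> 'I_0.*2.+1} := [ffun=> ord0].
  have Y0E i : centered 0 (Y0 i) = 0 by rewrite ffunE.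
  rewrite (bigD1 Y0); last by rewrite big1 // => i _; rewrite Y0E.
  apply: ler_wpDr.
    apply: sumr_ge0 => Y _; apply: prodr_ge0 => i _; exact: weight_ge0.
  apply: le_trans (half_expr_le R (Xle x)) _; rewrite expr_sum.
  apply: ler_prod => i _; rewrite Y0E addr0 exprn_ge0 ?(ltW m0) // andTb.
  by rewrite /weight ler_peMr ?exprn_ge0 ?(ltW m0) // lerDl exprn_ge0 // ltW.
move=> /(le_trans (ler_sum _ (fun x _ => term x))).
have W747 : 3735 / 10 <= 747 / 2 :> R by clear; lra.
have W0 : 0 <= 3735 / 10 :> R by clear; lra.
have V0 : 0 <= 747 / 2 :> R by clear; lra.
move=> /le_trans -/(_ _ (lerXn2r n W0 V0 W747)).
by rewrite expr_div_n exprVn sumr_const -[_ *+ _]mulr_natl ler_pM2r.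
Qed.

(** Numerically, [373.5 * 2 * rho ^ 48 / 98.9 < 2.9], as [rho ^ 48 < 0.38]. *)
Lemma code_bound_large (R : realType) : exists n0, forall n (T : finType)
    (X : T -> 'I_n -> int), (n0 <= n)%N -> code X ->
  #|T|%:R <= 2 * (29 / 10) ^+ n :> R.
Proof.
have [K tailK] := exists_long_range R.
have [n0 Hn0] := ball_weight_ge tailK.
exists n0 => n T X /Hn0 ball codeX; have [Xle _] := codeX.
have := code_packing R K codeX.
move=> /(le_trans (ler_sum _ (fun x _ => ball (X x) (Xle x)))).
have /andP[Z1 _] := noise_mass_bounds tailK.
have rho48 : rho R ^+ 48 <= 38 / 100 by rewrite /rho; clear; lra.
have rho48_gt0 : 0 < 2 * rho R ^+ 48.
  by rewrite mulr_gt0 // exprn_gt0 // rho_gt0.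
set b := noise_mass R K / _.
have b0 : 0 < b by rewrite divr_gt0 //; clear -Z1; lra.
have b1 : 3735 / 10 <= 29 / 10 * b.
  by rewrite /b mulrA ler_pdivlMr //; clear -Z1 rho48; lra.
have W0 : 0 <= 3735 / 10 :> R by clear; lra.
have V0 : 0 <= 29 / 10 * b by clear -b0; lra.
move=> /le_trans -/(_ _ (lerXn2r n W0 V0 b1)).
rewrite [(29 / 10 * b) ^+ n]exprMn sumr_const -[_ *+ _]mulr_natl mulrA.
rewrite ler_pdivrMr // [leRHS]mulrAC.
by rewrite ler_pM2r ?exprn_gt0 // (mulrC _ 2).
Qed.

(** * From kissing configurations to integer vectors *)

(** A common point [x + y / 2 = y' / 2] with [y] and [y'] in the cross-polytope
    writes [x] as [(y' - y) / 2]. *)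
Lemma kissing_norm_le1 (R : realType) (n : nat) (S : set 'rV[R]_n) x :
  kissing_configuration (@cross_polytope R n) S -> S x ->
  \sum_(i < n) `|x 0 i| <= 1.
Proof.
move=> [_ touch] /touch[[z [[y Ky <-] [y' Ky' eqz]]] _].
have -> : x = 2^-1 *: y' - 2^-1 *: y.
  by rewrite -[X in X - _]add0r eqz addrK.
apply: (@le_trans _ _ (\sum_(i < n) (2^-1 * `|y' 0 i| + 2^-1 * `|y 0 i|))).
  apply: ler_sum => i _; rewrite !mxE; apply: le_trans (ler_normB _ _) _.
  by rewrite !normrM gtr0_norm.
rewrite big_split /= -!mulr_sumr.
by move: Ky Ky'; rewrite /cross_polytope /=; lra.
Qed.

Lemma interior_half_translate (R : realType) (n : nat) (x z : 'rV[R]_n) :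
  \sum_(i < n) `|z 0 i - x 0 i| < 1 / 2 ->
  interior (half_translate (@cross_polytope R n) x) z.
Proof.
move=> zx.
have [d d0 dE] : exists2 d : R,
    0 < d & d + \sum_(i < n) `|z 0 i - x 0 i| = 1 / 2.
  by eexists; [rewrite -subr_gt0 in zx; exact: zx | rewrite subrK].
rewrite /interior; apply/nbhs_ballP; exists (d / n.+1%:R) => /=.
  by rewrite divr_gt0.
move=> u zu; exists (2 *: (u - x)); last first.
  by rewrite scalerA mulVf // scale1r addrC subrK.
rewrite /cross_polytope /=.
have close i : `|u 0 i - z 0 i| <= d / n.+1%:R.
  by have [_ /(_ 0 i)] := zu; rewrite /ball /= distrC => /ltW.
apply: (@le_trans _ _ (\sum_(i < n) 2 * (d / n.+1%:R + `|z 0 i - x 0 i|))).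
  apply: ler_sum => i _; rewrite !mxE normrM gtr0_norm // ler_pM2l //.
  rewrite -(subrK (z 0 i) (u 0 i)) -addrA.
  by rewrite (le_trans (ler_normD _ _)) // lerD2r.
rewrite -mulr_sumr big_split /= sumr_const card_ord -[_ *+ n]mulr_natr.
have : d / n.+1%:R * n%:R <= d.
  by rewrite mulrAC ler_pdivrMr // ler_pM2l // ler_nat.
by move: dE; set e : R := d / _ * _; clear; lra.
Qed.

(** If [x] and [x'] are closer than [1], their midpoint is interior to both
    translates. *)
Lemma kissing_separated (R : realType) (n : nat) (S : set 'rV[R]_n) x x' :
  kissing_configuration (@cross_polytope R n) S -> S x -> S x' -> x != x' ->
  1 <= \sum_(i < n) `|x 0 i - x' 0 i|.
Proof.
move=> [disj _] Sx Sx' /eqP xx'; rewrite leNgt; apply/negP => close.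
apply: xx'; apply: disj => //; exists (2^-1 *: (x + x')).
have half : \sum_(i < n) 2^-1 * `|x 0 i - x' 0 i| < 1 / 2.
  by rewrite -mulr_sumr; lra.
have mid (a b : R) : `|2^-1 * (a + b) - a| = 2^-1 * `|a - b|.
  by rewrite distrC -[in RHS](@gtr0_norm _ 2^-1) // -normrM; congr `|_|; field.
split; apply: interior_half_translate; apply: le_lt_trans half;
  apply: ler_sum => i _; rewrite !mxE; first by rewrite mid.
by rewrite addrC mid distrC.
Qed.

Definition grid_code (R : realType) (n : nat) (x : 'rV[R]_n) (i : 'I_n) : int :=
  Num.floor ((101 * n)%:R * x 0 i).

Lemma absz_floor_le (R : realType) (a : R) :
  (absz (Num.floor a))%:R <= `|a| + 1.
Proof.
have /andP[] := floor_itv a; rewrite natr_absz intr_norm intrD mulr1z.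
move: (_%:~R) => f f1 f2; have := ler_norm a; have := ler_norm (- a).
by rewrite normrN ler_norml; lra.
Qed.

Lemma absz_sub_floor_gt (R : realType) (a b : R) :
  `|a - b| - 1 < (absz (Num.floor a - Num.floor b))%:R.
Proof.
have /andP[] := floor_itv a; have /andP[] := floor_itv b.
rewrite natr_absz intr_norm rmorphB /= !intrD !mulr1z.
move: (Num.floor a)%:~R (Num.floor b)%:~R => fa fb b1 b2 a1 a2.
have := ler_norm (fa - fb); have := ler_norm (- (fa - fb)).
by rewrite normrN ltrBlDr ltr_norml; lra.
Qed.

(** Rounding moves each coordinate by less than one grid step, which changes
    lengths and distances by at most [n]. *)
Lemma grid_code_correct (R : realType) (n : nat) (S : set 'rV[R]_n)
    (B : {fset 'rV[R]_n}) : (1 <= n)%N ->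
  kissing_configuration (@cross_polytope R n) S -> [set` B] `<=` S ->
  code (fun x : B => grid_code (val x)).
Proof.
move=> n1 kissing BS; have n0 : 0 <= (101 * n)%:R :> R by [].
split=> [[x Bx]|[x Bx] [x' Bx'] neq] /=.
  rewrite -(ler_nat R) natr_sum.
  apply: (@le_trans _ _ (\sum_(i < n) ((101 * n)%:R * `|x 0 i| + 1))).
    apply: ler_sum => i _; apply: le_trans (absz_floor_le _) _.
    by rewrite normrM ger0_norm.
  rewrite big_split /= -mulr_sumr sumr_const card_ord.
  have := ler_wpM2l n0 (kissing_norm_le1 kissing (BS x Bx)).
  by rewrite mulr1 (natrM _ 101) (natrM _ 102); clear; lra.
rewrite -(ltr_nat R) natr_sum.
have sep : 1 <= \sum_(i < n) `|x 0 i - x' 0 i|.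
  by apply: kissing_separated kissing (BS x Bx) (BS x' Bx') _; exact: neq.
apply: (@le_lt_trans _ _
    (\sum_(i < n) ((101 * n)%:R * `|x 0 i - x' 0 i| - 1))).
  rewrite big_split /= -mulr_sumr sumr_const card_ord.
  have := ler_wpM2l n0 sep.
  by rewrite mulr1 mulNrn (natrM _ 101) (natrM _ 100); clear; lra.
apply: ltr_sum => [|i _].
  by apply/hasP; exists (Ordinal n1); rewrite ?mem_index_enum.
apply: le_lt_trans (absz_sub_floor_gt _ _).
by rewrite -mulrBr normrM ger0_norm.
Qed.

Lemma counting_le (R : realType) (T : choiceType) (S : set T) (b : R) :
  (forall B : {fset T}, [set` B] `<=` S -> (#|` B|)%:R <= b) ->
  (counting S <= b%:E)%E.
Proof.
move=> card_le; rewrite /counting; case: ifPn => [/asboolP finS|/asboolPn infS].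
  rewrite lee_fin; apply: card_le => x /=.
  by rewrite in_fset_set // in_setE.
have [B BS Bsize] := infinite_set_fset (Num.trunc b).+1 infS.
have := card_le B BS; rewrite leNgt => /negP[].
apply: lt_le_trans (truncnS_gt b) _.
by rewrite ler_nat.
Qed.

Lemma kissing_number_le (R : realType) (n : nat) (b : R) : (1 <= n)%N ->
  (forall (T : finType) (X : T -> 'I_n -> int), code X -> #|T|%:R <= b) ->
  (translative_kissing_number (@cross_polytope R n) <= b%:E)%E.
Proof.
move=> n1 code_le; apply: ge_ereal_sup => _ [S kissing <-].
apply: counting_le => B BS.
by have := code_le _ _ (grid_code_correct n1 kissing BS); rewrite -cardfE.
Qed.

Lemma eventually_mul_expr_le (R : realType) (c p q : R) :
  0 <= c -> 0 <= p < q ->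
  exists n0, forall n, (n0 <= n)%N -> c * p ^+ n <= q ^+ n.
Proof.
move=> c0 /andP[p0 pq]; have q0 := le_lt_trans p0 pq.
have pq01 : 0 <= p / q < 1.
  by rewrite divr_ge0 ?(ltW q0) // ltr_pdivrMr // mul1r.
have c1 : 0 < c + 1 by rewrite ltr_wpDl.
have ic1 : 0 < (c + 1)^-1 by rewrite invr_gt0.
have [n0 Hn0] := eventually_expr_le pq01 ic1.
exists n0 => n /Hn0; rewrite expr_div_n ler_pdivrMr ?exprn_gt0 //.
rewrite ler_pdivlMl //.
by apply: le_trans; rewrite ler_wpM2r ?exprn_ge0 // lerDl.
Qed.

Theorem theorem1 (R : realType) :
  exists eps : nat -> R,
    (eps n @[n --> \oo] --> (0 : R)) /\
    forall n : nat, (1 <= n)%N ->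
      (translative_kissing_number (@cross_polytope R n) <=
       ((29162%:R / 10000%:R : R) `^ ((1 + eps n) * n%:R))%:E)%E.
Proof.
have [n0 large] := code_bound_large R.
set base : R := 29162%:R / 10000%:R.
have base_gt : 291 / 100 <= base by rewrite /base; lra.
move: base base_gt => base base_gt.
have base_gt0 : 0 < base by lra.
have base_pow7 : 747 <= base ^+ 7.
  have b0 : 0 <= 291 / 100 :> R by lra.
  by apply: le_trans (lerXn2r 7 b0 (ltW base_gt0) base_gt); lra.
have [n1 two_le] : exists n1, forall n, (n1 <= n)%N ->
    2 * (29 / 10) ^+ n <= base ^+ n.
  by apply: eventually_mul_expr_le => //; lra.
(* [6] is large enough for all small dimensions, since [747 <= 2.91 ^ 7] *)
exists (fun n => if (maxn n0 n1 <= n)%N then 0 else 6); split.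
  by apply: cvg_near_cst; exists (maxn n0 n1) => // n /= ->.
move=> n n_gt0; apply: kissing_number_le => // T X codeX.
case: ifPn => [|_].
  rewrite geq_max => /andP[nn0 nn1].
  rewrite addr0 mul1r powR_mulrn ?(ltW base_gt0) //.
  exact: le_trans (large _ _ _ nn0 codeX) (two_le _ nn1).
have -> : (1 + 6) * n%:R = (7 * n)%:R :> R by rewrite natrM; ring.
rewrite powR_mulrn ?(ltW base_gt0) // exprM.
apply: le_trans (code_bound R codeX) _.
have b7 : 0 <= base ^+ 7 by rewrite exprn_ge0 // ltW.
have c7 : 0 <= 747 :> R by exact: ler0n.
exact: (lerXn2r n c7 b7 base_pow7).
Qed.
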